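(* (i) There exists an absolute constant $c>0$ such that the following holds. Let $X$ be a nonempty finite set, let $0<p\le 1$, and suppose that $\mathcal H\subseteq 2^X$ admits a fractional cover $w:2^X\to[0,1]$ such that $\sum_{W\in 2^X}w(W)p^{|W|}\le\tfrac12$. Then $\mathcal H$ is $q$-small for \[ q=\frac{cp}{\log\log(4|X|)}. \] (ii) Consequently, there is an absolute constant $C>0$ such that for every nonempty finite set $X$ and every $\mathcal H\subseteq 2^X$ for which the increasing family $\langle\mathcal H\rangle\subseteq 2^X$ is nontrivial, \[ p_E(\mathcal H)\le p_f(\mathcal H)\le C\,p_E(\mathcal H)\log\log(4|X|). \]
   Context: Logarithms are in base $2$. For $\mathcal H\subseteq 2^X$, $\langle\mathcal H\rangle=\{A\subseteq X: H\subseteq A\text{ for some }H\in\mathcal H\}$; it is nontrivial if it is neither $\emptyset$ nor $2^X$. A family $\mathcal G\subseteq 2^X$ is a cover of $\mathcal H$ if every $H\in\mathcal H$ contains some $G\in\mathcal G$ as a subset. $\mathcal H$ is $p$-small if it has a cover $\mathcal G\subseteq 2^X$ with $\sum_{G\in\mathcal G}p^{|G|}\le\tfrac12$. A fractional cover of $\mathcal H$ is a function $w:2^X\to[0,1]$ with $\sum_{W\subseteq H}w(W)\ge1$ for every $H\in\mathcal H$. The expectation threshold $p_E(\mathcal H)$ is the largest $p\in[0,1]$ such that $\mathcal H$ is $p$-small. The fractional expectation threshold $p_f(\mathcal H)$ is the largest $p\in[0,1]$ for which there is a fractional cover $w$ of $\mathcal H$ with $\sum_{W\in 2^X}w(W)p^{|W|}\le\tfrac12$.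 (Convention: $0^0=1$.) *)

(* Defs.v *)
From mathcomp Require Import all_boot all_order all_algebra.
From mathcomp Require Import all_classical all_reals all_analysis.

Set Implicit Arguments.
Unset Strict Implicit.
Unset Printing Implicit Defensive.

Import Order.TTheory GRing.Theory Num.Theory.

Local Open Scope ring_scope.

Definition log2 (R : realType) (x : R) : R := ln x / ln 2.

Definition upset (X : finType) (H : {set {set X}}) : {set {set X}} :=
  [set A : {set X} | [exists B in H, B \subset A]]%SET.

Definition nontrivial_family (X : finType) (F : {set {set X}}) : Prop :=
  F <> finset.set0 /\ F <> [set: {set X}]%SET.

Definition is_cover (X : finType) (G H : {set {set X}}) : Prop :=
  forall B, B \in H -> exists2 A, A \in G & A \subset B.

(* The power [_ ^+ n] satisfies 0 ^+ 0 = 1. *)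
Definition p_small (R : realType) (X : finType) (p : R)
    (H : {set {set X}}) : Prop :=
  exists2 G : {set {set X}}, is_cover G H & \sum_(A in G) p ^+ #|A| <= 1 / 2.

Definition fractional_cover (R : realType) (X : finType)
    (w : {set X} -> R) (H : {set {set X}}) : Prop :=
  (forall W, 0 <= w W <= 1) /\
  (forall B, B \in H -> 1 <= \sum_(W : {set X} | W \subset B) w W).

(* The largest element of [S], or 0 when [S] has none.  For the sets defining
   [p_E H] and [p_f H], the default is only used when the empty set belongs to
   [H], i.e. when [upset H] is the whole power set. *)
Definition largest (R : realType) (S : set R) : R :=
  xget 0 [set m | S m /\ forall x, S x -> x <= m]%classic.

Definition p_E (R : realType) (X : finType) (H : {set {set X}}) : R :=
  largest [set p : R | 0 <= p <= 1 /\ p_small p H]%classic.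

Definition p_f (R : realType) (X : finType) (H : {set {set X}}) : R :=
  largest [set p : R | 0 <= p <= 1 /\
    exists2 w : {set X} -> R, fractional_cover w H &
      \sum_(W : {set X}) w W * p ^+ #|W| <= 1 / 2]%classic.

(* Main.v *)
(* Let n = |X|, let s be least with 4n <= 2^(2^s), so that s = O(log log n), and
   put t = 2^s.  Since w(emptyset) <= 1/2, every member of H receives weight at
   least 1/4 either from sets of size > t or from nonempty sets of size <= t.

   Large sets.  Replacing p by q <= p/4 divides their cost by 4^t >= (4n)^2, while
   greedy set cover over at most 2^n sets to be covered loses only a factor 4(n+1).

   Small sets.  Each S in H carries the measure lam_S(v) proportional to the degree
   of v in the weighted hypergraph induced by w on S.  If a random set U of density
   at most p/16 captures all but a 1/(2t) fraction of lam_S for some S, then U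
   contains half of the weight inside S, which is unlikely since the expected
   weight inside U is at most 1/32.  Otherwise U yields a cheap integral cover of H:
   split S into groups of levels B^-(r+1) < lam_S <= B^-r, with B polylogarithmic,
   and expose U in O(s) rounds for each of three colours, group r using colour
   r mod 3.  Groups are treated in order of increasing weight, i.e. decreasing r.
   In a round one minimises the uncaptured part T of groups r - 1 and r.  Either
   its size has halved, or T is put into the cover: as in the Park-Pham argument,
   T is recovered from U together with T up to 2^O(|T|) choices, which makes such
   T cheap on average.  Lighter groups, once captured, are only required to keep a
   small uncaptured mass, whereas groups below r - 1 are kept fixed: they are so
   much smaller than T that one can afford a union bound over them.  All groups thus share the same O(s) rounds, which is where
   log log n comes from.

   For the second part, the maxima defining p_E and p_f exist by compactness of the
   set of pairs (p, w), integral covers being the 0/1-valued fractional covers. *)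
Require Import Defs.
From mathcomp Require Import all_boot all_order all_algebra.
From mathcomp Require Import zify ring lra.

Set Implicit Arguments.
Unset Strict Implicit.
Unset Printing Implicit Defensive.

Import Order.TTheory GRing.Theory Num.Theory.

Local Open Scope ring_scope.

(** * Random subsets *)

Section BernoulliSubset.
Variables (R : realFieldType) (Om : finType) (rho : R).

Definition bern (Z : {set Om}) : R :=
  \prod_(x : Om) (if x \in Z then rho else 1 - rho).

Lemma sum_bern : \sum_Z bern Z = 1.
Proof.
rewrite /bern -(bigA_distr _ _ (fun=> rho) (fun=> 1 - rho)).
by rewrite big1 // => i _ /=; ring.
Qed.

Lemma sum_bern_sup (F : {set Om}) :
  \sum_(Z : {set Om} | F \subset Z) bern Z = rho ^+ #|F|.
Proof.
have -> : rho ^+ #|F| =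
    \prod_(x : Om) (rho + (if x \in F then 0 else 1 - rho)).
  rewrite (bigID (mem F)) /= [X in _ * X]big1; last first.
    by move=> i /negbTE ->; ring.
  rewrite mulr1 (eq_bigr (fun=> rho)) ?prodr_const //.
  by move=> i ->; rewrite addr0.
rewrite (bigA_distr _ _ (fun=> rho)
  (fun x => if x \in F then 0 else 1 - rho)) [RHS](bigID (fun Z : {set Om} => F \subset Z)) /=.
rewrite [X in _ + X]big1 ?addr0.
  apply: eq_bigr => Z FZ; apply: eq_bigr => x _.
  case: ifP => // /negbT xZ; case: ifP => // xF.
  by rewrite (subsetP FZ _ xF) in xZ.
move=> Z /subsetPn[x xF xZ]; rewrite (bigD1 x) //=.
by rewrite (negbTE xZ) xF mul0r.
Qed.

Hypothesis rho01 : 0 <= rho <= 1.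

Lemma bern_ge0 Z : 0 <= bern Z.
Proof.
case/andP: rho01 => r0 r1.
by apply: prodr_ge0 => x _; case: ifP; rewrite ?subr_ge0.
Qed.

(** Taking [F] out of [Y] turns [#|F|] factors [rho] into [1 - rho], so the left side is
    [(1 - rho) ^+ #|F|] times the right side. *)
Lemma bern_remove (F Y : {set Om}) : F \subset Y ->
  bern (Y :\: F) * rho ^+ #|F| <= bern Y.
Proof.
move=> FY; case/andP: rho01 => r0 r1.
rewrite /bern (bigID (mem F)) [leRHS](bigID (mem F)) /=.
rewrite [X in _ * X * _](eq_bigr (fun x => if x \in Y then rho else 1 - rho)); last first.
  by move=> i /negbTE iF; rewrite inE iF.
rewrite [X in X * _ * _](eq_bigr (fun=> 1 - rho)); last by move=> i iF; rewrite inE iF.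
rewrite [X in _ <= X * _](eq_bigr (fun=> rho)); last first.
  by move=> i iF; rewrite (subsetP FY).
rewrite !prodr_const mulrAC ler_wpM2r //.
  by apply: prodr_ge0 => x _; case: ifP; rewrite ?subr_ge0.
rewrite ler_piMl ?exprn_ge0 // exprn_ile1 ?subr_ge0 //; lra.
Qed.

End BernoulliSubset.

(** A set of at most [m] points is the range of a map from ['I_m] to [option X], with [None] as
    padding. *)
Lemma card_small_sets (X : finType) m :
  (#|[set K : {set X} | #|K| <= m]| <= #|X|.+1 ^ m)%N.
Proof.
pose F (f : {ffun 'I_m -> option X}) := [set x | [exists i, f i == Some x]].
have -> : (#|X|.+1 ^ m = #|{: {ffun 'I_m -> option X}}|)%N.
  by rewrite card_ffun card_option card_ord.
apply: leq_trans (leq_imset_card F _); apply/subset_leq_card/subsetP => K.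
rewrite inE => Km; apply/imsetP.
exists [ffun i : 'I_m => nth None (map Some (enum K)) i] => //.
apply/setP => x; rewrite inE; apply/idP/existsP => [xK|[i]].
  have ix : (index x (enum K) < m)%N.
    by apply: leq_trans Km; rewrite cardE index_mem mem_enum.
  exists (Ordinal ix); rewrite ffunE /= (nth_map x) ?index_mem ?mem_enum //.
  by rewrite nth_index // mem_enum.
rewrite ffunE; case: (ltnP i (size (enum K))) => iK.
  rewrite (nth_map x) // => /eqP[<-].
  by rewrite -(mem_enum K) mem_nth.
by rewrite nth_default // size_map.
Qed.

(* [(Z, T)] is recovered from [Y = Z :|: f @: T] and the choice of a subset of
   [D Y], which costs a factor [2 ^ N], while [bern Z] exceeds [bern Y] by at
   most [rho ^- #|T|]. *)
Lemma fragment_cost (R : realFieldType) (Om X : finType) (f : X -> Om)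
    (D : {set Om} -> {set X}) (N : nat) (q rho l : R) :
  injective f -> 0 < rho <= 1 -> 0 <= q -> 1 <= l -> q * l ^+ 2 <= rho ->
  (forall Y, #|D Y| <= N)%N ->
  \sum_(Z : {set Om}) bern rho Z *
     \sum_(T : {set X} | [&& T \subset D (Z :|: f @: T),
                             [disjoint f @: T & Z] & (N < 2 * #|T|)%N])
       q ^+ #|T| <= (2 / l) ^+ N.
Proof.
move=> finj /andP[r0 r1] q0 l1 ql DN.
have l0 : 0 < l by apply: lt_le_trans l1.
have rr : 0 <= rho <= 1 by rewrite ltW.
under eq_bigr do rewrite mulr_sumr.
rewrite (exchange_big_dep predT) //=.
pose G (T : {set X}) (Y : {set Om}) := [&& T \subset D Y, f @: T \subset Y & (N < 2 * #|T|)%N].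
have step (T : {set X}) : \sum_(Z : {set Om} | [&& T \subset D (Z :|: f @: T),
      [disjoint f @: T & Z] & (N < 2 * #|T|)%N]) bern rho Z * q ^+ #|T| <=
    \sum_(Y | G T Y) bern rho Y * (l^-1) ^+ N.
  pose h (Z : {set Om}) := Z :|: f @: T.
  pose h' (Y : {set Om}) := Y :\: f @: T.
  rewrite [leRHS](reindex_onto h h') /=; last first.
    move=> Y /and3P[_ FY _]; apply/setP => x; rewrite !inE.
    by case: (boolP (x \in f @: T)) => [/(subsetP FY)->|]; rewrite ?orbT ?orbF.
  rewrite [X in _ <= X](eq_bigl (fun Z => [&& T \subset D (Z :|: f @: T),
      [disjoint f @: T & Z] & (N < 2 * #|T|)%N])); last first.
    move=> Z; rewrite /G /h /h' subsetUr /=.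
    case: (_ \subset _) => //=; rewrite andbC; congr (_ && _).
    apply/eqP/idP => [<-|dis]; first by rewrite -setI_eq0 setIDA setD_eq0 subsetIl.
    rewrite setDUl setDv setU0; apply/setDidPl.
    by rewrite disjoint_sym.
  apply: ler_sum => Z /and3P[_ dis NT].
  have := bern_remove rr (_ : f @: T \subset h Z); rewrite subsetUr => /(_ isT).
  have -> : h Z :\: f @: T = Z.
    by rewrite /h setDUl setDv setU0; apply/setDidPl; rewrite disjoint_sym.
  rewrite card_imset // => le.
  apply: le_trans (ler_wpM2r _ le); last by rewrite exprn_ge0 // invr_ge0 ltW.
  rewrite -mulrA ler_wpM2l ?bern_ge0 //.
  have q2 : q <= rho * (l^-1) ^+ 2.
    by rewrite exprVn ler_pdivlMr ?exprn_gt0.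
  apply: le_trans (lerXn2r _ _ _ q2) _; rewrite ?nnegrE //.
    by rewrite mulr_ge0 ?exprn_ge0 ?invr_ge0 // ltW.
  rewrite exprMn ler_wpM2l ?exprn_ge0 //; first exact: ltW.
  rewrite -exprM; apply: ler_wiXn2l; last exact: ltnW.
    by rewrite invr_ge0 ltW.
  by rewrite invf_le1.
apply: le_trans (ler_sum _ (fun T _ => step T)) _.
rewrite (exchange_big_dep predT) //=.
have -> : (2 / l) ^+ N = \sum_(Y : {set Om}) bern rho Y * (2 / l) ^+ N.
  by rewrite -mulr_suml sum_bern mul1r.
apply: ler_sum => Y _; rewrite sumr_const -mulrnAr ler_wpM2l ?bern_ge0 //.
rewrite exprMn -[leLHS]mulr_natl.
apply: ler_wpM2r; first by rewrite exprn_ge0 // invr_ge0 ltW.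
rewrite -[X in _ <= X ^+ _]/(2%:R) -natrX ler_nat.
apply: leq_trans (_ : #|powerset (D Y)| <= _)%N; last by rewrite card_powerset leq_exp2l.
by apply/subset_leq_card/subsetP => T; rewrite !inE => /and3P[].
Qed.

Lemma ler_sum_subpred (R : realFieldType) (I : finType) (P Q : pred I) (F : I -> R) :
  (forall i, P i -> Q i) -> (forall i, Q i -> 0 <= F i) ->
  \sum_(i | P i) F i <= \sum_(i | Q i) F i.
Proof.
move=> PQ F0; rewrite [leRHS](bigID P) /= (eq_bigl P) => [|i].
  by rewrite lerDl sumr_ge0 // => i /andP[/F0].
by apply: andb_idl => /PQ.
Qed.

(** * Multi-round exposure *)

Section Exposure.
Variables (R : realFieldType) (X : finType) (H : {set {set X}}).
Variables (lam : {set X} -> X -> R) (g : {set X} -> X -> nat) (B J : nat).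

Local Notation cell := ('I_3 * 'I_J)%type.

(* Three colours suffice for the groups adjacent to [r] to be unaffected by an
   exposure at [color r]; the next affected group is [r.+2]. *)
Definition color (r : nat) : 'I_3 := inord (r %% 3).

(** Every point has one copy per colour and round, and is captured as soon as one of the relevant
    copies is in [Z]. *)
Definition hit (Z : {set X * cell}) (c : 'I_3) (m : nat) (v : X) : bool :=
  [exists j : 'I_J, (j < m)%N && ((v, (c, j)) \in Z)].

(* Upper bound on the size of the frontier of group [r] before its round [j]. *)
Definition cap (r j : nat) : nat := (B ^ r.+1 %/ 2 ^ j)%N.

Definition low (r : nat) (S : {set X}) : {set X} :=
  [set v in S | (g S v).+1 < r]%N.

(* Elements of level [r] may also have been captured while group [r.+1] was
   exposed, those of level [r.-1] only by the earlier rounds of group [r]. *)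
Definition frontier (r j : nat) (S : {set X}) (Z : {set X * cell}) : {set X} :=
  [set v in S | [&& ((g S v).+1 == r) || (g S v == r), ~~ hit Z (color r) j v
                  & (g S v == r) ==> ~~ hit Z (color r.+1) J v]].

Definition missed (S : {set X}) (Z : {set X * cell}) (v : X) : bool :=
  [&& v \in S, ~~ hit Z (color (g S v)) J v & ~~ hit Z (color (g S v).+1) J v].

Definition lost (r : nat) (S : {set X}) (Z : {set X * cell}) : R :=
  \sum_(v | missed S Z v && (r <= g S v)%N) lam S v.

Definition place (r : nat) (j : 'I_J) (v : X) : X * cell := (v, (color r, j)).

(** The test uses only [Y] and [K]. If [T] is the part of the frontier of [S] that round [j] leaves
    uncaptured, adding [place r j @: T] to [Z] makes [S] meet the last condition. *)
Definition decodable r (j : 'I_J) (K : {set X}) (Y : {set X * cell}) S : bool :=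
  [&& S \in H, low r S == K, (#|frontier r j S Y| <= cap r j)%N
    & place r j @: frontier r j S Y \subset Y].

(* A choice of [frontier r j S] depending only on the exposed set together with the
   fragment [T] that was uncaptured. *)
Definition decode r (j : 'I_J) (K : {set X}) (Y : {set X * cell}) : {set X} :=
  if [pick S | decodable r j K Y S] is Some S0 then
    frontier r j [arg min_(S < S0 | decodable r j K Y S) lost r.+1 S Y]%O Y
  else set0.

Definition fragment r (j : 'I_J) (K : {set X}) (Z : {set X * cell}) (T : {set X}) :=
  [&& T \subset decode r j K (Z :|: place r j @: T),
      [disjoint place r j @: T & Z] & (cap r j < 2 * #|T|)%N].

Lemma color_neq r : color r.+1 != color r.
Proof.
apply/eqP => /(congr1 val); rewrite /= !inordK ?ltn_pmod //.
have := ltn_pmod r (isT : 0 < 3)%N; lia.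
Qed.

Lemma color_eq r s : color s = color r -> (r < s)%N -> (r.+2 < s)%N.
Proof. by move=> /(congr1 val); rewrite /= !inordK ?ltn_pmod //; lia. Qed.

Lemma hitU (Z : {set X * cell}) r (j : 'I_J) (T : {set X}) c m v :
  hit (Z :|: place r j @: T) c m v =
  hit Z c m v || [&& c == color r, (j < m)%N & v \in T].
Proof.
apply/existsP/orP => [[k /andP[km]]|].
  rewrite inE => /orP[vZ|/imsetP[u uT [-> -> kj]]].
    by left; apply/existsP; exists k; rewrite km.
  by right; rewrite eqxx uT andbT -kj.
case=> [/existsP[k /andP[km vZ]]|/and3P[/eqP -> jm vT]].
  by exists k; rewrite km inE vZ.
by exists j; rewrite jm inE; apply/orP; right; apply/imsetP; exists v.
Qed.

Lemma hitS (Z : {set X * cell}) c (j : 'I_J) v :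
  hit Z c j.+1 v = hit Z c j v || ((v, (c, j)) \in Z).
Proof.
apply/existsP/orP => [[k /andP[]]|].
  rewrite ltnS leq_eqVlt => /orP[/eqP/val_inj -> ->|kj vZ]; first by right.
  by left; apply/existsP; exists k; rewrite kj.
case=> [/existsP[k /andP[km vZ]]|vZ].
  by exists k; rewrite vZ andbT ltnW.
by exists j; rewrite ltnSn.
Qed.

Lemma frontierU r (j : 'I_J) S (Z : {set X * cell}) (T : {set X}) :
  frontier r j S (Z :|: place r j @: T) = frontier r j S Z.
Proof.
by apply/setP => v; rewrite !inE !hitU ltnn (negbTE (color_neq r)) /= !orbF andbF orbF.
Qed.

Lemma frontierS r (j : 'I_J) S (Z : {set X * cell}) :
  frontier r j.+1 S Z = [set v in frontier r j S Z | place r j v \notin Z].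
Proof.
apply/setP => v; rewrite !inE hitS negb_or /place -!andbA.
by do !bool_congr.
Qed.

Lemma frontierS_sub r (j : 'I_J) S (Z : {set X * cell}) :
  frontier r j.+1 S Z \subset frontier r j S Z.
Proof. by rewrite frontierS; apply/subsetP => v; rewrite inE => /andP[]. Qed.

Hypothesis lam_ge0 : forall S v, 0 <= lam S v.

Lemma lostU_le r s (j : 'I_J) S (Z : {set X * cell}) (T : {set X}) :
  lost s S (Z :|: place r j @: T) <= lost s S Z.
Proof.
rewrite /lost; apply: ler_sum_subpred => // v.
by rewrite /missed !hitU !negb_or => /andP[/and3P[-> /andP[-> _] /andP[-> _]] ->].
Qed.

Hypothesis B_gt0 : (0 < B)%N.
Hypothesis lam_le : forall S v, S \in H -> v \in S -> lam S v <= (B%:R ^+ g S v)^-1.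

(** With three colours, a point of level above [r] that the added cells capture has level at least
    [r.+2]; so it lies outside the frontier and its [lam] is at most [B^-(r+2)]. *)
Lemma le_lostU r (j : 'I_J) S (Z : {set X * cell}) (T : {set X}) : S \in H ->
  lost r.+1 S Z <= lost r.+1 S (Z :|: place r j @: T)
                   + #|T :\: frontier r j S Z|%:R / B%:R ^+ r.+2.
Proof.
move=> SH.
have B0 : 0 < B%:R :> R by rewrite ltr0n.
rewrite {1}/lost (bigID (missed S (Z :|: place r j @: T))) /=; apply: lerD.
  by apply: ler_sum_subpred => // v /andP[/andP[_ ->] ->].
have -> : #|T :\: frontier r j S Z|%:R / B%:R ^+ r.+2 =
    \sum_(v in T :\: frontier r j S Z) (B%:R ^+ r.+2)^-1 :> R.
  by rewrite sumr_const -[RHS]mulr_natl.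
rewrite big_mkcond /= [leRHS]big_mkcond /=; apply: ler_sum => v _.
case: ifP => [|_]; last by case: ifP; rewrite // invr_ge0 exprn_ge0 // ltW.
move=> /andP[/andP[/and3P[vS h1 h2] rg]].
rewrite /missed vS !hitU (negbTE h1) (negbTE h2) (ltn_ord j) /= => notm.
have [vT rg2] : v \in T /\ (r.+1 < g S v)%N.
  move: notm; case: (v \in T); rewrite ?andbF ?andbT //= => notm; split=> //.
  move: notm; rewrite negb_and !negbK => /orP[] /eqP/color_eq; first by move=> /(_ rg)/ltnW.
  by rewrite !ltnS => /(_ (ltnW rg)).
rewrite !inE vT vS /= andbT.
have -> : ((g S v).+1 == r) || (g S v == r) = false by apply/negbTE; lia.
rewrite /=; apply: le_trans (lam_le SH vS) _.
rewrite lef_pV2 ?posrE ?exprn_gt0 // ler_weXn2l // ler1n //.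
Qed.

(* Minimise [Phi S = |T_S| + B^(r+2) / 2 * lost], where [T_S] is the frontier left by
   this round.  If [U] is decoded from [Y], then [T_U] is contained in [T := T_S], and
   removing [T :\: T_U] from [Y] raises the lost mass of [U] by at most
   [|T :\: T_U| / B^(r+2)];
   minimality of [S] therefore forces [T_U = T]. *)
Lemma exposure_step r (j : 'I_J) (A S0 : {set X}) (Z : {set X * cell}) :
    S0 \in H -> frontier r j S0 Z \subset A -> (#|frontier r j S0 Z| <= cap r j)%N ->
  (exists2 T : {set X}, T \subset A & fragment r j (low r S0) Z T) \/
  exists S, [/\ S \in H, low r S = low r S0, frontier r j.+1 S Z \subset A,
    (#|frontier r j.+1 S Z| <= cap r j.+1)%N &
    lost r.+1 S Z <= lost r.+1 S0 Z + 2 * (cap r j)%:R / B%:R ^+ r.+2].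
Proof.
move=> S0H F0A F0cap; set K := low r S0; set b : R := B%:R ^+ r.+2.
have b0 : 0 < b by rewrite exprn_gt0 // ltr0n.
pose P S := [&& S \in H, low r S == K, (#|frontier r j S Z| <= cap r j)%N &
               frontier r j.+1 S Z \subset A].
pose Phi S : R := #|frontier r j.+1 S Z|%:R + b / 2 * lost r.+1 S Z.
have P0 : P S0.
  by rewrite /P S0H eqxx F0cap (subset_trans (frontierS_sub _ _ _ _)).
case: (@arg_minP _ _ _ S0 P Phi P0) => S /and4P[SH lowS Scap SA] Smin.
have lostS : lost r.+1 S Z <= lost r.+1 S0 Z + 2 * (cap r j)%:R / b.
  have h : Phi S <= Phi S0 by apply: Smin.
  have h1 : b * lost r.+1 S Z <= b * lost r.+1 S0 Z + 2 * (cap r j)%:R.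
    have h2 : (#|frontier r j.+1 S0 Z|%:R : R) <= (cap r j)%:R.
      by rewrite ler_nat (leq_trans _ F0cap) // subset_leq_card // frontierS_sub.
    have h3 : (0 : R) <= #|frontier r j.+1 S Z|%:R by [].
    by move: h; rewrite /Phi; lra.
  have -> : lost r.+1 S0 Z + 2 * (cap r j)%:R / b =
            (b * lost r.+1 S0 Z + 2 * (cap r j)%:R) / b by field; rewrite gt_eqF.
  by rewrite ler_pdivlMr // mulrC.
set T := frontier r j.+1 S Z.
have [big|small] := ltnP (cap r j) (2 * #|T|); last first.
  right; exists S; split=> //; first exact/eqP.
  (* [cap r j.+1] is [cap r j] halved and rounded down, so [2 * #|T| <= cap r j] suffices. *)
  rewrite /cap (expnSr 2) divnMA leq_divRL // mulnC.
  exact: small.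
left; exists T => //; rewrite /fragment big andbT.
have disTZ : [disjoint place r j @: T & Z].
  rewrite -setI_eq0; apply/eqP/setP => x; rewrite !inE; apply/negbTE/negP.
  case/andP => /imsetP[v]; rewrite /T frontierS !inE => /andP[_ vZ] ->.
  by rewrite (negbTE vZ).
rewrite disTZ andbT /decode; set Y := Z :|: _.
have TE U : (frontier r j U Z :&: T) = frontier r j.+1 U Z :&: T.
  apply/setP => v; rewrite !in_setI frontierS inE.
  case: (boolP (v \in T)); rewrite ?andbF //.
  rewrite !andbT => vT; rewrite (_ : _ \notin Z) ?andbT //.
  apply: contraL disTZ => vZ; apply/pred0Pn.
  by exists (place r j v); rewrite !inE vZ andbT imset_f.
have candS : decodable r j K Y S.
  rewrite /decodable SH lowS frontierU Scap /=.
  apply/subsetP => _ /imsetP[v vF ->]; rewrite inE.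
  case: (boolP (_ \in Z)) => //= vZ; apply/imset_f.
  by rewrite /T frontierS inE vF.
case: pickP => [S1 cS1|/(_ S)]; last by rewrite candS.
case: arg_minP => // U /and4P[UH lowU Ucap UY] Umin.
rewrite frontierU in Ucap UY *.
(* A copy of a frontier point of [U] that is not in [Z] can only have entered [Y] through [T]. *)
have UT : frontier r j.+1 U Z \subset T.
  rewrite frontierS; apply/subsetP => v; rewrite inE => /andP[vF vZ].
  have := subsetP UY _ (imset_f (place r j) vF); rewrite inE (negbTE vZ) /=.
  by case/imsetP => w wT [->].
(* Replacing [S] by [U] lowers the first term of [Phi] by [#|T :\: frontier r j U Z|] and, thanks to
   the weight [b / 2], raises the second by at most half of that; so this number is 0. *)
have := Smin U; rewrite /P UH lowU Ucap (subset_trans UT SA) => /(_ isT).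
have eU := le_lostU r j Z T UH.
have eS : lost r.+1 U Y <= lost r.+1 S Z.
  by apply: le_trans (Umin _ candS) _; apply: lostU_le.
have -> : T \subset frontier r j U Z = (T :\: frontier r j U Z == set0) by rewrite setD_eq0.
rewrite -cards_eq0 -leqn0 -(ler_nat R).
have : #|T|%:R = #|frontier r j.+1 U Z|%:R + #|T :\: frontier r j U Z|%:R :> R.
  rewrite -natrD -(cardsID (frontier r j U Z) T) setIC TE.
  by rewrite (setIidPl UT).
rewrite /Phi -/T => cT h.
have : b * lost r.+1 U Z <= b * lost r.+1 S Z + #|T :\: frontier r j U Z|%:R.
  have -> : b * lost r.+1 S Z + #|T :\: frontier r j U Z|%:R =
            b * (lost r.+1 S Z + #|T :\: frontier r j U Z|%:R / b).
    by field; rewrite gt_eqF.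
  by rewrite ler_pM2l //; apply: le_trans eU _; rewrite lerD2r.
move: h cT; lra.
Qed.

Hypothesis card_le :
  forall S r, S \in H -> (#|[set v in S | (g S v <= r)%N]| <= B ^ r.+1)%N.

(** [low r] has levels at most [r - 2], so [card_le] allows it [B^(r-1)] points; it is empty for
    [r < 2]. *)
Definition prefix_size (r : nat) : nat := if r is r'.+2 then (B ^ r'.+1)%N else 0%N.

Lemma card_low r S : S \in H -> (#|low r S| <= prefix_size r)%N.
Proof.
move=> SH; case: r => [|[|r]] /=; last first.
- apply: leq_trans (card_le r SH).
  by apply/subset_leq_card/subsetP => v; rewrite !inE.
- by rewrite leqn0 cards_eq0; apply/eqP/setP => v; rewrite !inE andbF.
- by rewrite leqn0 cards_eq0; apply/eqP/setP => v; rewrite !inE andbF.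
Qed.

Definition covered (m : nat) (Z : {set X * cell}) (A : {set X}) : Prop :=
  exists r (j : 'I_J) (K T : {set X}),
    [/\ (r <= m)%N, (#|K| <= prefix_size r)%N, T \subset A & fragment r j K Z T].

(** A round adds at most [2 * cap r j / B^(r+2)] to the lost mass, and [cap r j <= B^(r+1)], whence
    [2 / B] per round. *)
Lemma exposure_rounds m r (A S0 : {set X}) (Z : {set X * cell}) eta :
    (r <= m)%N -> S0 \in H -> low r S0 \subset A -> frontier r 0 S0 Z \subset A ->
    lost r.+1 S0 Z <= eta ->
  covered m Z A \/
  exists S, [/\ S \in H, low r S \subset A, frontier r J S Z \subset A,
    (#|frontier r J S Z| <= cap r J)%N & lost r.+1 S Z <= eta + J%:R * (2 / B%:R)].
Proof.
move=> rm S0H lowA F0A lost0.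
have B0 : 0 < B%:R :> R by rewrite ltr0n.
suff h j : (j <= J)%N -> covered m Z A \/
  exists S, [/\ S \in H, low r S \subset A, frontier r j S Z \subset A,
    (#|frontier r j S Z| <= cap r j)%N & lost r.+1 S Z <= eta + j%:R * (2 / B%:R)].
  exact: h.
elim: j => [_|j IH jJ].
  right; exists S0; split => //; last by rewrite mul0r addr0.
  rewrite /cap expn0 divn1; apply: leq_trans (card_le r S0H).
  apply/subset_leq_card/subsetP => v; rewrite !inE => /andP[-> /=]; lia.
have [|[S [SH lowS FA Fcap lostS]]] := IH (ltnW jJ); first by left.
have [[T TA Tfr]|[S' [S'H lowE F'A F'cap lostS']]] :=
  exposure_step (j := Ordinal jJ) SH FA Fcap.
  by left; exists r, (Ordinal jJ), (low r S), T; rewrite rm TA card_low.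
right; exists S'; split=> //; first by rewrite lowE.
apply: le_trans lostS' _; rewrite -[j.+1]addn1 natrD (mulrDl j%:R) mul1r addrA lerD //.
rewrite -mulrA ler_pM2l // ler_pdivrMr ?exprn_gt0 // exprS mulKf ?gt_eqF //.
by rewrite -natrX ler_nat leq_div.
Qed.

(** The missed points of level exactly [r] lie in the last frontier of group [r], which has at most
    [B^(r+1) / 2^J] points, each of mass at most [B^-r]. *)
Lemma lost_le r S (Z : {set X * cell}) : S \in H ->
    (#|frontier r J S Z| <= cap r J)%N ->
  lost r S Z <= lost r.+1 S Z + B%:R / 2 ^+ J.
Proof.
move=> SH Fcap; have B0 : 0 < B%:R :> R by rewrite ltr0n.
rewrite {1}/lost (bigID (fun v => r < g S v)%N) /=; apply: lerD.
  by apply: ler_sum_subpred => // v /andP[/andP[-> _] ->].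
apply: (@le_trans _ _ (\sum_(v in frontier r J S Z) (B%:R ^+ r)^-1)).
  apply: (@le_trans _ _
      (\sum_(v | missed S Z v && (r <= g S v)%N && ~~ (r < g S v)%N) (B%:R ^+ r)^-1)).
    apply: ler_sum => v /andP[/andP[/and3P[vS _ _] rg] gr].
    apply: le_trans (lam_le SH vS) _.
    by rewrite lef_pV2 ?posrE ?exprn_gt0 // ler_weXn2l ?ler1n.
  apply: ler_sum_subpred => [v|v _]; last by rewrite invr_ge0 exprn_ge0 // ltW.
  rewrite /missed inE -leqNgt => /andP[/andP[/and3P[-> h1 h2] rg] gr].
  have e : g S v = r by apply/eqP; rewrite eqn_leq gr rg.
  by move: h1 h2; rewrite e eqxx orbT => -> ->.
rewrite sumr_const -[leLHS]mulr_natl ler_pdivrMr ?exprn_gt0 //.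
apply: (@le_trans _ _ (cap r J)%:R); first by rewrite ler_nat.
rewrite mulrAC -exprS ler_pdivlMr ?exprn_gt0 // -!natrX -natrM ler_nat.
exact: leq_divM.
Qed.

Lemma exposure (m : nat) (A : {set X}) (Z : {set X * cell}) :
    (forall S v, S \in H -> v \in S -> (g S v <= m)%N) -> A \in H ->
  covered m Z A \/
  exists2 S, S \in H & \sum_(v | missed S Z v) lam S v <=
     m.+1%:R * (J%:R * (2 / B%:R) + B%:R / 2 ^+ J).
Proof.
move=> gm AH; set eta := _ + B%:R / _.
have B0 : 0 < B%:R :> R by rewrite ltr0n.
(* Downward induction from group [m] to group 0. Each completed group costs [eta]: the loss in its
   rounds plus what stays uncaptured at its level. *)
suff h d : (d <= m)%N -> covered m Z A \/ exists S,
    [/\ S \in H, low (m - d) S \subset A, frontier (m - d) J S Z \subset A,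
      (#|frontier (m - d) J S Z| <= cap (m - d) J)%N &
      lost (m - d).+1 S Z <= d%:R * eta + J%:R * (2 / B%:R)].
  have [|[S [SH _ _ Fcap lostS]]] := h m (leqnn _); first by left.
  right; exists S => //; rewrite subnn in Fcap lostS.
  apply: (@le_trans _ _ (lost 0 S Z)).
    by rewrite /lost; apply: ler_sum_subpred => // v ->.
  apply: le_trans (lost_le SH Fcap) _.
  apply: le_trans (lerD lostS (lexx _)) _.
    by rewrite -[m.+1]addn1 natrD (mulrDl m%:R) mul1r -addrA.
elim: d => [_|d IH dm].
  rewrite subn0; apply: (exposure_rounds (S0 := A)) => //.
  - by apply/subsetP => v; rewrite inE => /andP[].
  - by apply/subsetP => v; rewrite inE => /andP[].
  - rewrite mul0r /lost big1 // => v /andP[/and3P[vA _ _]].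
    by rewrite ltnNge gm.
have [|[S [SH lowA FA Fcap lostS]]] := IH (ltnW dm); first by left.
have e : (m - d = (m - d.+1).+1)%N by rewrite subnSK.
move: lowA FA Fcap lostS; rewrite e; set r := (m - d.+1)%N => lowA FA Fcap lostS.
apply: (exposure_rounds (S0 := S)) => //.
- exact: leq_subr.
- apply: subset_trans lowA; apply/subsetP => v; rewrite !inE => /andP[->] /=.
  by move=> /ltnW.
(* Level [r - 1] was part of [low r.+1], and the points of level [r] not captured by the colour of
   [r.+1] were in the last frontier of group [r.+1]; both lie in [A]. *)
- apply/subsetP => v; rewrite inE => /and3P[vS /orP[gv|gv]].
    by move=> _; apply: (subsetP lowA); rewrite inE vS (eqP gv) /=.
  move=> /andP[_]; rewrite gv /= => hv; apply: (subsetP FA).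
  by rewrite inE vS (eqP gv) eqxx hv ltn_eqF.
- apply: le_trans (lost_le SH Fcap) _.
  apply: le_trans (lerD lostS (lexx _)) _.
  by rewrite -[d.+1]addn1 natrD (mulrDl d%:R) mul1r -!addrA.
Qed.

End Exposure.

(** * Averaging over random exposures *)

Lemma bern_average (R : realFieldType) (Om : finType) (rho c : R) (F : {set Om} -> R) :
  0 <= rho <= 1 -> \sum_Z bern rho Z * F Z < c -> exists Z, F Z < c.
Proof.
move=> rho01 lt; apply/existsP; apply: contraLR lt.
rewrite -leNgt => /existsPn h; rewrite -[c]mul1r -(sum_bern Om rho) mulr_suml.
by apply: ler_sum => Z _; rewrite ler_wpM2l ?bern_ge0 // leNgt.
Qed.

Definition support (X I : finType) (Z : {set X * I}) : {set X} :=
  [set v | [exists i, (v, i) \in Z]].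

(** Union bound over the [#|I| ^ #|W|] ways to choose one copy of each point of [W]. *)
Lemma bern_support (R : realFieldType) (X I : finType) (rho : R) (W : {set X}) :
  0 <= rho <= 1 ->
  \sum_(Z : {set X * I} | W \subset support Z) bern rho Z <= (#|I|%:R * rho) ^+ #|W|.
Proof.
move=> rho01; have [i0 _|I0] := pickP (@predT I); last first.
  have [->|[x xW]] := set_0Vmem W.
    rewrite cards0 expr0 -(sum_bern (X * I)%type rho).
    by apply: ler_sum_subpred => // Z _; rewrite bern_ge0.
  rewrite big1 ?exprn_ge0 ?mulr_ge0 //; first by case/andP: rho01.
  by move=> Z /subsetP/(_ _ xW); rewrite inE => /existsP[i]; have := I0 i.
pose F (a : {ffun X -> I}) := [set (v, a v) | v in W].
have cardF a : #|F a| = #|W| by rewrite card_imset // => u v [].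
apply: (@le_trans _ _ (\sum_(a in pffun_on i0 (mem W) predT)
    \sum_(Z : {set X * I} | F a \subset Z) bern rho Z)); last first.
  under eq_bigr => a _ do rewrite sum_bern_sup cardF.
  by rewrite sumr_const card_pffun_on exprMn -natrX mulr_natl.
rewrite (exchange_big_dep predT) //= big_mkcond /=; apply: ler_sum => Z _.
rewrite sumr_const; case: ifP => [WZ|_]; last by rewrite mulrn_wge0 // bern_ge0.
rewrite -[leRHS]mulr_natl ler_peMl ?bern_ge0 // ler1n.
apply/card_gt0P.
exists [ffun v => if v \in W then odflt i0 [pick i | (v, i) \in Z] else i0].
apply/andP; split.
  apply/pffun_onP; split=> [|//]; apply/subsetP => v.
  by rewrite !inE ffunE; case: ifP; rewrite ?eqxx.
apply/subsetP => _ /imsetP[v vW ->]; rewrite ffunE vW.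
case: pickP => [//|none]; have := subsetP WZ _ vW.
by rewrite inE => /existsP[i]; rewrite none.
Qed.

Lemma ler_sum_union (R : realFieldType) (T I : finType) (P : pred T) (Q : I -> pred T)
    (F : T -> R) :
  (forall t, 0 <= F t) -> (forall t, P t -> exists i, Q i t) ->
  \sum_(t | P t) F t <= \sum_i \sum_(t | Q i t) F t.
Proof.
move=> F0 PQ; rewrite (exchange_big_dep predT) //= big_mkcond /=; apply: ler_sum => t _.
case: ifP => [/PQ[i Qi]|_]; last by rewrite sumr_ge0.
by rewrite (bigD1 i) //= lerDl sumr_ge0.
Qed.

Section FragmentFamily.
Variables (R : realFieldType) (X : finType) (H : {set {set X}}).
Variables (lam : {set X} -> X -> R) (g : {set X} -> X -> nat) (B J m : nat).

Definition fragments (Z : {set X * ('I_3 * 'I_J)}) : {set {set X}} :=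
  [set T | [exists r : 'I_m.+1, exists j : 'I_J, exists K : {set X},
     (#|K| <= prefix_size B r)%N && fragment H lam g B r j K Z T]].

Lemma coveredP (Z : {set X * ('I_3 * 'I_J)}) A : covered H lam g B m Z A ->
  exists2 T, T \in fragments Z & T \subset A.
Proof.
move=> [r [j [K [T [rm Kr TA Tfr]]]]]; exists T => //; rewrite inE.
apply/existsP; exists (Ordinal (rm : r < m.+1)%N); apply/existsP; exists j.
by apply/existsP; exists K; rewrite Kr.
Qed.

Lemma card_decode r (j : 'I_J) K Y : (#|decode H lam g B r j K Y| <= cap B r j)%N.
Proof.
rewrite /decode; case: pickP => [S0 cS0|_]; last by rewrite cards0.
by case: arg_minP => // S /and4P[].
Qed.

Variables (q rho l : R).
Hypotheses (rho01 : 0 < rho <= 1) (q0 : 0 <= q) (l1 : 1 <= l) (ql : q * l ^+ 2 <= rho).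

(** Union bound over [r], [j] and [K], each triple being an instance of [fragment_cost]. *)
Lemma fragments_cost :
  \sum_Z bern rho Z * (\sum_(T in fragments Z) q ^+ #|T|) <=
  \sum_(r < m.+1) \sum_(j < J)
    (if cap B r j == 0%N then 0 else #|X|.+1%:R ^+ prefix_size B r * (2 / l) ^+ cap B r j).
Proof.
have rr : 0 <= rho <= 1 by case/andP: rho01 => /ltW ->.
pose Ks (r : nat) := [set K : {set X} | #|K| <= prefix_size B r]%N.
pose cost (r : nat) (j : 'I_J) (K : {set X}) Z :=
  \sum_(T | fragment H lam g B r j K Z T) q ^+ #|T|.
apply: (@le_trans _ _ (\sum_Z bern rho Z *
   \sum_(r < m.+1) \sum_(j < J) \sum_(K in Ks r) cost r j K Z)).
  apply: ler_sum => Z _; rewrite ler_wpM2l ?bern_ge0 //.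
  have qT (T : {set X}) : 0 <= q ^+ #|T| by rewrite exprn_ge0.
  pose QK (r : nat) j (K : {set X}) T :=
    (#|K| <= prefix_size B r)%N && fragment H lam g B r j K Z T.
  apply: (@le_trans _ _ (\sum_(r < m.+1)
      \sum_(T | [exists j, exists K, QK r j K T]) q ^+ #|T|)).
    apply: ler_sum_union => // T; rewrite inE => /existsP[r h]; by exists r.
  apply: ler_sum => r _.
  apply: (@le_trans _ _ (\sum_(j < J) \sum_(T | [exists K, QK r j K T]) q ^+ #|T|)).
    by apply: ler_sum_union => // T /existsP[j h]; exists j.
  apply: ler_sum => j _; rewrite [leRHS]big_mkcond /=.
  apply: (@le_trans _ _ (\sum_K \sum_(T | QK r j K T) q ^+ #|T|)).
    by apply: ler_sum_union => // T /existsP[K h]; exists K.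
  apply: ler_sum => K _; rewrite inE /QK; case: leqP => //= _.
  by rewrite big_pred0_eq.
under eq_bigr do rewrite mulr_sumr.
rewrite exchange_big; apply: ler_sum => r _.
under eq_bigr do rewrite mulr_sumr.
rewrite exchange_big; apply: ler_sum => j _.
under eq_bigr do rewrite mulr_sumr.
rewrite exchange_big /=.
(* A zero cap forces the decoded set, hence [T], to be empty, which [cap B r j < 2 * #|T|]
   excludes. *)
case: eqP => [cap0|_].
  rewrite big1 // => K _; rewrite big1 // => Z _; rewrite /cost big1 ?mulr0 // => T.
  case/and3P => TD _; have := @card_decode r j K (Z :|: place r j @: T).
  rewrite cap0 leqn0 cards_eq0 => /eqP D0; move: TD.
  by rewrite D0 subset0 => /eqP ->; rewrite cards0.
apply: (@le_trans _ _ (\sum_(K in Ks r) (2 / l) ^+ cap B r j)).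
  apply: ler_sum => K _.
  by apply: fragment_cost => // [u v [] //|Y]; apply: card_decode.
have l0 : 0 < l by apply: lt_le_trans l1.
rewrite sumr_const -[leLHS]mulr_natl ler_wpM2r ?exprn_ge0 ?divr_ge0 //; first exact: ltW.
by rewrite -natrX ler_nat; apply: card_small_sets.
Qed.

End FragmentFamily.

(** * Fractional covers by small sets *)

(** With [y = 2^s] one has [B = 2^10 y^4] and [2^J = 2^13 y^6] for [J = rounds s]. Thus [B / 2^J]
    and [2 J / B] are at most [1 / (8 y^2)], while [2^s 2^J <= B^2] lets the caps absorb the union
    bound over [low]. *)
Definition base (s : nat) : nat := (2 ^ (4 * s + 10))%N.
Definition rounds (s : nat) : nat := (6 * s + 13)%N.

Lemma rounds_le s : (rounds s <= 2 ^ (s + 4))%N.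
Proof.
by have := ltn_expl s (isT : 1 < 2)%N; rewrite /rounds expnD (_ : 2 ^ 4 = 16)%N //; lia.
Qed.

(** The caps of group 0 are [2^(b-j)], down to 1. Since [2^(b-j) >= b-j+1], a geometric series with
    [x / (1 - x) <= 1/63] bounds the sum. *)
Lemma first_group_sum (R : realFieldType) (x : R) b J : 0 <= x -> 64 * x <= 1 ->
  63 * \sum_(j < J) (if (2 ^ b %/ 2 ^ j == 0)%N then 0 else x ^+ (2 ^ b %/ 2 ^ j)) <=
  x ^+ (b.+1 - J).
Proof.
move=> x0 x64; have x1 : x <= 1 by lra.
elim: J => [|J IH]; first by rewrite big_ord0 mulr0 exprn_ge0.
rewrite big_ord_recr /= mulrDr; apply: le_trans (lerD IH (lexx _)) _.
have [Jb|bJ] := leqP J b; last first.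
  rewrite divn_small ?ltn_exp2l //= mulr0 addr0.
  by rewrite (_ : b.+1 - J = b.+1 - J.+1)%N //; lia.
have -> : (2 ^ b %/ 2 ^ J = 2 ^ (b - J))%N.
  by rewrite -{1}(subnK Jb) expnD mulnK // expn_gt0.
rewrite expn_eq0 /= subSS subSn //.
have h : x ^+ (2 ^ (b - J)) <= x ^+ (b - J).+1 by apply: ler_wiXn2l => //; apply: ltn_expl.
have y0 : 0 <= x ^+ (b - J) by rewrite exprn_ge0.
move: h y0; rewrite exprS; move: (x ^+ (2 ^ _)) (x ^+ (b - J)) => u v h v0.
have := ler_wpM2r v0 x64; lra.
Qed.

(** Only group 0 needs care, as its caps reach 1. In higher groups all caps are at least [2^(2s+8)],
    and counting the terms crudely is enough. *)
Lemma fragment_budget (R : realFieldType) (n s : nat) : (n < 2 ^ (2 ^ s))%N ->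
  \sum_(r < (2 ^ s).+1) \sum_(j < rounds s)
    (if cap (base s) r j == 0%N then 0
     else n.+1%:R ^+ prefix_size (base s) r * (2 / 256) ^+ cap (base s) r j) <= 16^-1 :> R.
Proof.
(* [2 / 256] is the [2 / l] of [fragment_cost]; the extra factor 2 pays for the choice of [K]. *)
move=> ns; have [x [x0 x64 xE]] : exists x : R, [/\ 0 <= x, 64 * x = 1 & x = 2 * (2 / 256)].
  by exists (2 * (2 / 256)); split=> //; [lra|field].
have x1 : x <= 1 by lra.
have B2 : (base s ^ 2 = 2 ^ (8 * s + 20))%N by rewrite /base -expnM; congr (_ ^ _)%N; lia.
have B0 : (0 < base s)%N by rewrite expn_gt0.
have term r (j : 'I_(rounds s)) : cap (base s) r j != 0%N ->
  n.+1%:R ^+ prefix_size (base s) r * (2 / 256) ^+ cap (base s) r j <= x ^+ cap (base s) r j.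
  move=> cap0.
  rewrite xE [leRHS]exprMn; apply: ler_wpM2r; first by rewrite exprn_ge0 //; lra.
  rewrite -!natrX ler_nat.
  case: r cap0 => [|[|r]] _; rewrite /= ?expn0 ?expn_gt0 //.
  apply: (@leq_trans (2 ^ (2 ^ s * base s ^ r.+1))).
    by rewrite expnM leq_exp2r ?expn_gt0 ?B0.
  rewrite leq_exp2l // /cap leq_divRL ?expn_gt0 //.
  rewrite [leqRHS](_ : _ = base s ^ r.+1 * base s ^ 2)%N; last first.
    by rewrite -expnD; congr (_ ^ _)%N; lia.
  rewrite mulnAC mulnC leq_mul2l; apply/orP; right.
  by rewrite B2 -expnD leq_exp2l //; have := ltn_ord j; rewrite /rounds; lia.
rewrite big_ord_recl /=.
have h0 : \sum_(j < rounds s) (if cap (base s) 0 j == 0%N then 0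
     else n.+1%:R ^+ prefix_size (base s) 0 * (2 / 256) ^+ cap (base s) 0 j) <= 63^-1 :> R.
  have := @first_group_sum _ x (4 * s + 10) (rounds s) x0.
  rewrite x64 (_ : (4 * s + 10).+1 - rounds s = 0)%N; last by rewrite /rounds; lia.
  move=> /(_ (lexx _)); set S := \sum_(j < _) _ => hS; apply: (@le_trans _ _ S); last by lra.
  apply: ler_sum => j _; have := term 0%N j; rewrite /cap expn1 /base.
  by case: eqP => // _; apply.
set k := (2 ^ (2 * s + 8))%N.
have k1 : (0 < k)%N by rewrite expn_gt0.
have h1 : \sum_(i < 2 ^ s) \sum_(j < rounds s) (if cap (base s) (bump 0 i) j == 0%N then 0
     else n.+1%:R ^+ prefix_size (base s) (bump 0 i) * (2 / 256) ^+ cap (base s) (bump 0 i) j)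
     <= 32^-1 :> R.
  apply: (@le_trans _ _ (\sum_(i < 2 ^ s) \sum_(j < rounds s) x ^+ k)).
    apply: ler_sum => i _; apply: ler_sum => j _; case: ifP => [_|/negbT cap0].
      by rewrite exprn_ge0.
    apply: le_trans (term _ _ cap0) _; apply: ler_wiXn2l => //.
    rewrite /cap leq_divRL ?expn_gt0 //.
    apply: (@leq_trans (base s ^ 2)); last by rewrite leq_pexp2l //.
    by rewrite B2 -expnD leq_exp2l //; have := ltn_ord j; rewrite /rounds; lia.
  rewrite !sumr_const !card_ord -mulrnA -[leLHS]mulr_natl.
  apply: (@le_trans _ _ (2 ^+ k * x ^+ k)).
    rewrite ler_wpM2r ?exprn_ge0 // -natrX ler_nat.
    apply: (@leq_trans k); last exact/ltnW/ltn_expl.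
    rewrite mulnC; apply: leq_trans (leq_mul (leqnn _) (rounds_le s)) _.
    by rewrite -expnD leq_exp2l //; lia.
  rewrite -exprMn.
  apply: (@le_trans _ _ ((2 * x) ^+ 1)); last by rewrite expr1; lra.
  by apply: ler_wiXn2l => //; lra.
by apply: le_trans (lerD h0 h1) _; lra.
Qed.

Lemma missed_budget (R : realFieldType) (s : nat) :
  (2 ^ s).+1%:R * ((rounds s)%:R * (2 / (base s)%:R) + (base s)%:R / 2 ^+ rounds s)
    <= (2 * 2 ^+ s)^-1 :> R.
Proof.
set y : R := 2 ^+ s; have y0 : 0 < y by rewrite exprn_gt0.
have y1 : 1 <= y by rewrite exprn_ege1 //; lra.
have Bx : (base s)%:R = y ^+ 4 * 2 ^+ 10 :> R.
  by rewrite /base natrX exprD mulnC exprM.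
have Jx : 2 ^+ rounds s = y ^+ 6 * 2 ^+ 13 :> R by rewrite /rounds exprD mulnC exprM.
have Jle : (rounds s)%:R <= y * 2 ^+ 4 :> R.
  by rewrite /y -exprD -natrX ler_nat rounds_le.
have mE : (2 ^ s).+1%:R = y + 1 :> R by rewrite -addn1 natrD natrX.
have h1 : (rounds s)%:R * (2 / (base s)%:R) <= (8 * y ^+ 2)^-1.
  rewrite Bx mulrA ler_pdivrMr ?mulr_gt0 ?exprn_gt0 //.
  have -> : (8 * y ^+ 2)^-1 * (y ^+ 4 * 2 ^+ 10) = 2 ^+ 7 * y ^+ 2.
    by field; rewrite gt_eqF.
  have := ler_wpM2l (ltW y0) y1; rewrite mulr1 -expr2; lra.
have h2 : (base s)%:R / 2 ^+ rounds s = (8 * y ^+ 2)^-1.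
  by rewrite Bx Jx; field; rewrite gt_eqF.
rewrite mE h2.
apply: (@le_trans _ _ ((y + 1) * ((8 * y ^+ 2)^-1 + (8 * y ^+ 2)^-1))).
  by rewrite ler_pM2l ?lerD2r //; lra.
have -> : (y + 1) * ((8 * y ^+ 2)^-1 + (8 * y ^+ 2)^-1) = (y + 1) / (2 * y) * (2 * y)^-1.
  by field; rewrite gt_eqF.
rewrite ler_piMl ?invr_ge0 //; first lra.
rewrite ler_pdivrMr; lra.
Qed.

(** * Degrees in the weighted hypergraph *)

Section Degree.
Variables (R : realFieldType) (X : finType) (w : {set X} -> R) (s : nat).
Hypothesis w0 : forall W, 0 <= w W.
Hypothesis wsize : forall W, w W != 0 -> (0 < #|W| <= 2 ^ s)%N.

Definition mass (S : {set X}) : R := \sum_(W : {set X} | W \subset S) w W.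

(** As sets of nonzero weight have at most [2^s] points, the factor [2^s] makes the total at most 1.
    If [mass S] is 0, the quotient is 0 by convention. *)
Definition degree (S : {set X}) (v : X) : R :=
  (\sum_(W : {set X} | (W \subset S) && (v \in W)) w W) / (2 ^+ s * mass S).

(** [find] returns [2 ^ s] when no index qualifies, so the last group collects all points of degree
    at most [B^-(2^s)]. *)
Definition level (S : {set X}) (v : X) : nat :=
  find (fun r => ((base s)%:R ^+ r.+1)^-1 < degree S v) (iota 0 (2 ^ s)).

Lemma mass_ge0 S : 0 <= mass S.
Proof. exact: sumr_ge0. Qed.

Lemma degree_ge0 S v : 0 <= degree S v.
Proof. by rewrite divr_ge0 ?sumr_ge0 // mulr_ge0 ?mass_ge0 ?exprn_ge0. Qed.

Lemma sum_degree S : \sum_v degree S v <= 1.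
Proof.
rewrite -mulr_suml (exchange_big_dep (fun W : {set X} => W \subset S)) /=; last first.
  by move=> v W _ /andP[].
have [m0|m0] := eqVneq (mass S) 0; first by rewrite m0 mulr0 invr0 mulr0 ler01.
have mp : 0 < mass S by rewrite lt_neqAle eq_sym m0 mass_ge0.
rewrite ler_pdivrMr ?mulr_gt0 ?exprn_gt0 // mul1r /mass mulr_sumr.
apply: ler_sum => W WS; rewrite (eq_bigl (fun v => v \in W)); last by move=> v; rewrite WS.
rewrite sumr_const -[leLHS]mulr_natl; have [->|/wsize/andP[_ Ws]] := eqVneq (w W) 0.
  by rewrite !mulr0.
by rewrite ler_wpM2r // -natrX ler_nat.
Qed.

Lemma base_gt0 : 0 < (base s)%:R :> R.
Proof. by rewrite ltr0n expn_gt0. Qed.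

Lemma base_ge1 : 1 <= (base s)%:R :> R.
Proof. by rewrite ler1n expn_gt0. Qed.

Lemma level_le S v : (level S v <= 2 ^ s)%N.
Proof. by rewrite /level -[leqRHS](size_iota 0) find_size. Qed.

Lemma degree_le S v : degree S v <= ((base s)%:R ^+ level S v)^-1.
Proof.
case E : (level S v) => [|k].
  rewrite expr0 invr1; apply: le_trans (sum_degree S).
  by rewrite (bigD1 v) //= lerDl sumr_ge0 // => u _; apply: degree_ge0.
have kl : (k < level S v)%N by rewrite E.
have := before_find 0%N kl; rewrite nth_iota ?add0n; last first.
  exact: leq_trans kl (level_le S v).
by move/negbT; rewrite -leNgt.
Qed.

Hypothesis Xs : (#|X| < 2 ^ (2 ^ s))%N.

(** For [r < 2^s] each counted point has degree above [B^-(r+1)], and degrees sum to at most 1; for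
    larger [r] the size of [X] is bound enough. *)
Lemma card_level (S : {set X}) r : (#|[set v in S | (level S v <= r)%N]| <= base s ^ r.+1)%N.
Proof.
have [rm|mr] := ltnP r (2 ^ s); last first.
  apply: leq_trans (max_card _) _; apply: leq_trans (ltnW Xs) _.
  apply: (@leq_trans (2 ^ r.+1)); first by rewrite leq_exp2l // ltnW.
  by rewrite leq_exp2r // /base -[X in (X <= _)%N]expn1 leq_exp2l //; lia.
rewrite -(ler_nat R) natrX.
set L := [set v in S | _].
have : \sum_(v in L) ((base s)%:R ^+ r.+1)^-1 <= 1 :> R.
  apply: le_trans (sum_degree S).
  apply: (@le_trans _ _ (\sum_(v in L) degree S v)); last first.
    by apply: ler_sum_subpred => // v _; apply: degree_ge0.
  apply: ler_sum => v; rewrite inE => /andP[_ vr].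
  have lm : (level S v < 2 ^ s)%N by apply: leq_ltn_trans rm.
  have hs : has (fun r => ((base s)%:R ^+ r.+1)^-1 < degree S v) (iota 0 (2 ^ s)).
    by rewrite has_find size_iota.
  have := nth_find 0%N hs; rewrite nth_iota // add0n => /ltW; apply: le_trans.
  by rewrite lef_pV2 ?posrE ?exprn_gt0 ?base_gt0 // ler_weXn2l ?base_ge1.
by rewrite sumr_const -[X in X <= _]mulr_natl ler_pdivrMr ?exprn_gt0 ?base_gt0 // mul1r.
Qed.

(** A set inside [S] but not inside [U] has a point satisfying [P]; such sets weigh at most
    [2^s * mass S] times the total degree on [P], hence at most half of [mass S]. *)
Lemma mass_support (S U : {set X}) (P : pred X) :
  (forall v, v \in S -> v \notin U -> P v) ->
  \sum_(v | P v) degree S v <= (2 * 2 ^+ s)^-1 -> mass S / 2 <= mass U.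
Proof.
move=> PU small.
have [m0|m0] := eqVneq (mass S) 0; first by rewrite m0 mul0r mass_ge0.
have mp : 0 < mass S by rewrite lt_neqAle eq_sym m0 mass_ge0.
have s0 : 0 < 2 ^+ s :> R by rewrite exprn_gt0.
have h : \sum_(W : {set X} | (W \subset S) && ~~ (W \subset U)) w W <= mass S / 2.
  apply: (@le_trans _ _ (2 ^+ s * mass S * \sum_(v | P v) degree S v)); last first.
    have -> : mass S / 2 = 2 ^+ s * mass S * (2 * 2 ^+ s)^-1 by field; rewrite gt_eqF.
    by rewrite ler_pM2l ?mulr_gt0.
  rewrite mulr_sumr.
  under [leRHS]eq_bigr => v _ do rewrite /degree mulrC divfK ?mulf_neq0 ?gt_eqF //.
  rewrite (exchange_big_dep (fun W : {set X} => W \subset S)) /=; last by move=> v W _ /andP[].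
  rewrite big_mkcondr /=; apply: ler_sum => W WS.
  case: ifP => [/subsetPn[v vW vU]|_]; last exact: sumr_ge0.
  rewrite (bigD1 v) /=; first by rewrite lerDl sumr_ge0.
  by rewrite WS vW PU // (subsetP WS).
have : mass S <= mass S / 2 + mass U.
  rewrite {1}/mass (bigID (fun W : {set X} => W \subset U)) /= addrC lerD //.
  by apply: ler_sum_subpred => // W /andP[].
lra.
Qed.

End Degree.

Lemma small_support_cover (R : realFieldType) (X : finType) (H : {set {set X}})
    (w : {set X} -> R) (p q : R) (s : nat) :
  (forall W, 0 <= w W) -> (forall W, w W != 0 -> (0 < #|W| <= 2 ^ s)%N) ->
  (forall A, A \in H -> 4^-1 <= mass w A) ->
  \sum_W w W * p ^+ #|W| <= 2^-1 -> (#|X| < 2 ^ (2 ^ s))%N -> 0 < q -> p <= 1 ->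
  16 * (3 * rounds s)%:R * (q * 256 ^+ 2) <= p ->
  exists2 G : {set {set X}}, is_cover G H & \sum_(A in G) q ^+ #|A| <= 4^-1.
Proof.
move=> w0 wsize massH wp Xs q0 p1 qp.
(* [rho] is the least density allowed by [fragment_cost] with [l = 256]; having [3 * J] copies, a
   point is in the support with probability at most [p / 16]. *)
set J := rounds s; set B := base s; pose rho := q * 256 ^+ 2.
have rho0 : 0 < rho by rewrite mulr_gt0 // exprn_gt0.
have J1 : 1 <= (3 * J)%:R :> R by rewrite ler1n /J /rounds; lia.
have p0 : 0 < p by apply: lt_le_trans qp; rewrite !mulr_gt0 //; lra.
have Jrho : (3 * J)%:R * rho <= p / 16 by rewrite /rho; move: qp; rewrite -/J; lra.
have rho1 : rho <= 1 by have := ler_wpM2r (ltW rho0) J1; lra.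
have rho01 : 0 <= rho <= 1 by rewrite (ltW rho0).
pose fr := @fragments R X H (degree w s) (level w s) B J (2 ^ s).
pose cost Z := \sum_(T in fr Z) q ^+ #|T|.
have Ecost : \sum_Z bern rho Z * cost Z <= 16^-1.
  apply: le_trans (fragment_budget R Xs); apply: fragments_cost; rewrite ?rho0 //; first exact: ltW.
  by lra.
have Emass : \sum_(Z : {set X * ('I_3 * 'I_J)}) bern rho Z * mass w (support Z) <= 32^-1.
  under eq_bigr do rewrite mulr_sumr.
  rewrite (exchange_big_dep predT) //=.
  apply: (@le_trans _ _ (16^-1 * \sum_W w W * p ^+ #|W|)); last by lra.
  rewrite mulr_sumr; apply: ler_sum => W _; rewrite -mulr_suml.
  have [->|/wsize/andP[W0 _]] := eqVneq (w W) 0; first by rewrite !(mulr0, mul0r).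
  rewrite mulrC mulrCA ler_wpM2l //.
  apply: le_trans (bern_support _ _ rho01) _; rewrite card_prod !card_ord.
  apply: (@le_trans _ _ ((p / 16) ^+ #|W|)).
    apply: lerXn2r => //; rewrite nnegrE; last by rewrite divr_ge0 // ltW.
    by rewrite mulr_ge0 // ltW.
  rewrite exprMn mulrC; apply: ler_wpM2r; first by rewrite exprn_ge0 // ltW.
  by rewrite -[leRHS]expr1; apply: ler_wiXn2l => //; lra.
(* The expectation is at most [4/16 + 8/32 = 1/2]. *)
have [Z ZF] : exists Z, 4 * cost Z + 8 * mass w (support Z) < 1.
  apply: (bern_average rho01).
  under eq_bigr do rewrite mulrDr mulrCA [X in _ + X]mulrCA.
  by rewrite big_split -!mulr_sumr /=; lra.
have c0 : 0 <= cost Z by apply: sumr_ge0 => T _; rewrite exprn_ge0 // ltW.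
have m0 := mass_ge0 w0 (support Z).
exists (fr Z); last by rewrite -/(cost Z); lra.
move=> A AH.
have [/coveredP[T TZ TA]|[S SH Smiss]] := exposure (lam := degree w s) (g := level w s)
    (fun S v => degree_ge0 _ w0 S v) (expn_gt0 _ _ : 0 < B)%N
    (fun S v _ _ => degree_le w0 wsize S v) (fun S r _ => card_level w0 wsize Xs S r)
    (m := 2 ^ s) Z (fun S v _ _ => level_le _ _ S v) AH.
  by exists T.
(* Here half of the mass of [S], at least 1/8, would lie inside the support, against the choice of
   [Z]. *)
have := mass_support w0 (U := support Z) (S := S) _ (le_trans Smiss (missed_budget R s)).
move=> h; suff : 8^-1 <= mass w (support Z) by lra.
have := massH _ SH; have : mass w S / 2 <= mass w (support Z); last by lra.
apply: h => v vS; rewrite inE => /existsPn vZ; rewrite /missed vS /=.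
by apply/andP; split; apply/existsPn => j; rewrite negb_and vZ orbT.
Qed.

(** * Fractional covers by large sets *)

Definition harmonic_sum (R : realFieldType) (k : nat) : R := \sum_(i < k) (i.+1%:R)^-1.

Lemma harmonic_sum_le (R : realFieldType) n k : (k <= 2 ^ n)%N ->
  harmonic_sum R k <= n.+1%:R.
Proof.
have le_nn a b : (a <= b)%N -> harmonic_sum R a <= harmonic_sum R b.
  move=> ab; rewrite /harmonic_sum -!(big_mkord xpredT (fun i => (i.+1%:R : R)^-1)).
  by rewrite [leRHS](big_cat_nat (leq0n a) ab) /= lerDl sumr_ge0 // => i _; rewrite invr_ge0.
elim: n k => [|n IH] k kn.
  by apply: le_trans (le_nn _ _ kn) _; rewrite /harmonic_sum big_ord1 invr1.
apply: le_trans (le_nn _ _ kn) _.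
have le2 : (2 ^ n <= 2 ^ n.+1)%N by rewrite leq_exp2l.
rewrite /harmonic_sum -(big_mkord xpredT (fun i => (i.+1%:R : R)^-1)).
rewrite (big_cat_nat (leq0n _) le2) /= big_mkord -[n.+2]addn1 natrD; apply: lerD; first exact: IH.
apply: (@le_trans _ _ (\sum_(2 ^ n <= i < 2 ^ n.+1) (2 ^+ n)^-1)).
  apply: ler_sum_nat => i /andP[ni _].
  by rewrite lef_pV2 ?posrE ?exprn_gt0 // -natrX ler_nat ltnW.
rewrite sumr_const_nat expnS mul2n -addnn addnK -[leLHS]mulr_natl -natrX divff //.
by rewrite pnatr_eq0 -lt0n expn_gt0.
Qed.

(** By averaging, some [W] covers members of [H] at a price of at most [C / (d * #|H|)] each.
    Removing them and repeating makes the prices add up to a harmonic sum. *)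
Lemma greedy_cover (R : realFieldType) (X : finType) (w c : {set X} -> R) (d : R)
    (H : {set {set X}}) :
  (forall W, 0 <= w W) -> (forall W, 0 <= c W) -> 0 < d ->
  (forall A, A \in H -> d <= mass w A) ->
  exists2 G : {set {set X}}, is_cover G H &
    \sum_(W in G) c W <= (\sum_W w W * c W) / d * harmonic_sum R #|H|.
Proof.
move=> w0 c0 d0; set C := \sum_W _.
have C0 : 0 <= C by apply: sumr_ge0 => W _; rewrite mulr_ge0.
elim: {H}_.+1 {-2}H (ltnSn #|H|) => // k IH H Hk massH.
have [->|[A AH]] := set_0Vmem H.
  exists set0; first by move=> B; rewrite inE.
  rewrite big_set0 mulr_ge0 ?divr_ge0 ?(ltW d0) //.
  by apply: sumr_ge0 => i _; rewrite invr_ge0.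
pose hit (W : {set X}) := [set B in H | W \subset B].
have h0 : 0 < #|H|%:R :> R by rewrite ltr0n; apply/card_gt0P; exists A.
have [W /andP[W0 cW]] : exists W, (0 < #|hit W|)%N && (c W * (#|H|%:R * d) <= C * #|hit W|%:R).
  apply/existsP; apply: contraT => /existsPn none.
  have bad W : (0 < #|hit W|)%N -> C * #|hit W|%:R < c W * (#|H|%:R * d).
    by move=> hW; move: (none W); rewrite hW /= -ltNge.
  have total : #|H|%:R * d <= \sum_W w W * #|hit W|%:R.
    apply: (@le_trans _ _ (\sum_(B in H) mass w B)).
      by rewrite mulr_natl -sumr_const; apply: ler_sum.
    rewrite (exchange_big_dep predT) //=; apply: ler_sum => W _.
    rewrite sumr_const -[leLHS]mulr_natl mulrC ler_wpM2l // ler_nat.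
    by apply/subset_leq_card/subsetP => B; rewrite !inE => /andP[-> ->].
  have le W : w W * (C * #|hit W|%:R) <= w W * (c W * (#|H|%:R * d)).
    rewrite ler_wpM2l //; case: (posnP #|hit W|) => [->|/bad/ltW//].
    by rewrite mulr0 !mulr_ge0 // ltW.
  (* A set of positive weight inside [A] makes the comparison of the weighted sums strict. *)
  have [V wV VA] : exists2 V, w V != 0 & V \subset A.
    apply/exists_inP; apply: contraLR (massH A AH) => /exists_inPn none'.
    rewrite -ltNge /mass big1 // => V VA; apply/eqP.
    by apply: contraTT VA => /none'.
  have hV : (0 < #|hit V|)%N by apply/card_gt0P; exists A; rewrite inE AH.
  suff : C * (#|H|%:R * d) < C * (#|H|%:R * d) by rewrite ltxx.
  apply: (@le_lt_trans _ _ (\sum_W w W * (C * #|hit W|%:R))).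
    under eq_bigr do rewrite mulrCA.
    by rewrite -mulr_sumr ler_wpM2l.
  rewrite mulr_suml; under [ltRHS]eq_bigr do rewrite -mulrA.
  rewrite (bigD1 V) //= [ltRHS](bigD1 V) //= ltr_leD //; last by apply: ler_sum.
  by rewrite ltr_pM2l ?bad // lt_neqAle eq_sym wV w0.
have sub : hit W \subset H by apply/subsetP => B; rewrite inE => /andP[].
have cardD : #|H :\: hit W| = (#|H| - #|hit W|)%N by rewrite cardsD (setIidPr sub).
have cardle : (#|hit W| <= #|H|)%N by apply: subset_leq_card.
have [||G Gcov Gcost] := IH (H :\: hit W).
- by rewrite cardD; lia.
- by move=> B; rewrite inE => /andP[_ /massH].
exists (W |: G).
  move=> B BH; case: (boolP (W \subset B)) => WB; first by exists W; rewrite // !inE eqxx.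
  have [|D DG DB] := Gcov B; first by rewrite !inE BH (negbTE WB).
  by exists D; rewrite // !inE DG orbT.
apply: (@le_trans _ _ (c W + \sum_(V in G) c V)).
  have [WG|WG] := boolP (W \in G); last by rewrite big_setU1.
  by rewrite (setUidPr _) ?sub1set // lerDr.
apply: le_trans (lerD (lexx _) Gcost) _.
rewrite cardD /harmonic_sum -!(big_mkord xpredT (fun i => (i.+1%:R : R)^-1)).
rewrite [X in _ <= _ * X](big_cat_nat (leq0n _) (leq_subr #|hit W| _)) /= mulrDr addrC lerD2l.
apply: (@le_trans _ _ (C / d * (#|hit W|%:R / #|H|%:R))).
  have -> : C / d * (#|hit W|%:R / #|H|%:R) = C * #|hit W|%:R / (#|H|%:R * d).
    by field; rewrite !gt_eqF.
  by rewrite ler_pdivlMr // mulr_gt0.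
rewrite ler_wpM2l ?divr_ge0 ?(ltW d0) //.
rewrite -[X in X / _](_ : \sum_(#|H| - #|hit W| <= i < #|H|) 1 = _); last first.
  by rewrite sumr_const_nat subKn.
rewrite mulr_suml; apply: ler_sum_nat => i /andP[_ iH].
by rewrite mul1r lef_pV2 ?posrE // ler_nat.
Qed.

Lemma large_support_cover (R : realFieldType) (X : finType) (H : {set {set X}})
    (w : {set X} -> R) (p q : R) (s : nat) :
  (forall W, 0 <= w W) -> (forall W, w W != 0 -> (2 ^ s < #|W|)%N) ->
  (forall A, A \in H -> 4^-1 <= mass w A) ->
  \sum_W w W * p ^+ #|W| <= 2^-1 -> (0 < #|X|)%N -> (4 * #|X| <= 2 ^ (2 ^ s))%N ->
  0 <= q -> 4 * q <= p ->
  exists2 G : {set {set X}}, is_cover G H & \sum_(A in G) q ^+ #|A| <= 4^-1.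
Proof.
move=> w0 wsize massH wp X0 Xs q0 qp.
have [||G Gcov Gcost] := @greedy_cover R X w (fun W => q ^+ #|W|) 4^-1 H w0 _ _ massH.
- by move=> W; rewrite exprn_ge0.
- by lra.
exists G => //; apply: le_trans Gcost _; set C := \sum_W _; set t := (2 ^ s)%N in Xs *.
have C0 : 0 <= C by apply: sumr_ge0 => W _; rewrite mulr_ge0 // exprn_ge0.
have y0 : 0 < 2 ^+ t :> R by rewrite exprn_gt0.
have Cle : C * (2 ^+ t) ^+ 2 <= 2^-1.
  apply: le_trans wp; rewrite mulr_suml; apply: ler_sum => W _.
  rewrite -mulrA; have [->|/wsize Wt] := eqVneq (w W) 0; first by rewrite !mul0r.
  rewrite ler_wpM2l //; apply: (@le_trans _ _ (q ^+ #|W| * 4 ^+ #|W|)).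
    rewrite ler_wpM2l ?exprn_ge0 // -exprM mulnC exprM.
    have -> : 2 ^+ 2 = 4 :> R by ring.
    by apply: ler_weXn2l; [lra | exact: ltnW].
  rewrite -exprMn; apply: lerXn2r; rewrite ?nnegrE; lra.
have hle : harmonic_sum R #|H| <= #|X|.+1%:R.
  by apply: harmonic_sum_le; apply: leq_trans (max_card _) _; rewrite -cardsT -powersetT card_powerset cardsT.
have nle : 2 * #|X|.+1%:R <= 2 ^+ t :> R.
  by rewrite -natrX -natrM ler_nat; lia.
have y4 : 4 <= 2 ^+ t :> R by rewrite -natrX ler_nat; lia.
move: Cle nle y0 y4; set y := 2 ^+ t; clearbody y => Cle nle y0 y4.
rewrite invrK; apply: (@le_trans _ _ (C * 4 * #|X|.+1%:R)).
  by rewrite ler_wpM2l // mulr_ge0.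
have h1 : C * y <= 8^-1.
  have : C * y * 4 <= C * y * y by rewrite ler_wpM2l // mulr_ge0 // ltW.
  by move: Cle; rewrite expr2; lra.
have : C * (2 * #|X|.+1%:R) <= C * y by rewrite ler_wpM2l.
lra.
Qed.

(** * Expectation thresholds *)

From mathcomp Require Import all_classical all_reals all_analysis.
Import numFieldNormedType.Exports.

Lemma fractional_cover_p_small (R : realType) (X : finType) (H : {set {set X}})
    (w : {set X} -> R) (p q : R) (s : nat) :
  (0 < #|X|)%N -> (4 * #|X| <= 2 ^ (2 ^ s))%N -> p <= 1 -> 0 < q ->
  16 * (3 * rounds s)%:R * (q * 256 ^+ 2) <= p ->
  fractional_cover w H -> \sum_(W : {set X}) w W * p ^+ #|W| <= 1 / 2 ->
  p_small q H.
Proof.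
move=> X0 Xs p1 q0 qp [w01 wH] wp.
have J1 : 1 <= (3 * rounds s)%:R :> R by rewrite ler1n /rounds; lia.
have e1 : 1 <= 256 ^+ 2 :> R by rewrite exprn_ege1 //; lra.
have qe : q <= q * 256 ^+ 2 by rewrite ler_peMr // ltW.
have qp4 : 4 * q <= p.
  move: qp qe J1; move: (q * 256 ^+ 2) ((3 * rounds s)%:R : R) => u v uv qu v1.
  have : u * 1 <= u * v by rewrite ler_wpM2l //; lra.
  lra.
have p0 : 0 < p by lra.
have w0 W : 0 <= w W by case/andP: (w01 W).
pose small (W : {set X}) := (0 < #|W| <= 2 ^ s)%N.
pose large (W : {set X}) := (2 ^ s < #|W|)%N.
pose ws W := if small W then w W else 0.
pose wl W := if large W then w W else 0.
have ws0 W : 0 <= ws W by rewrite /ws; case: ifP.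
have wl0 W : 0 <= wl W by rewrite /wl; case: ifP.
have cost_le (u : {set X} -> R) : (forall W, u W <= w W) -> \sum_W u W * p ^+ #|W| <= 2^-1.
  move=> uw; rewrite -[2^-1]div1r; apply: le_trans wp; apply: ler_sum => W _.
  by rewrite ler_wpM2r // exprn_ge0 // ltW.
have wset0 : w finset.set0 <= 2^-1.
  rewrite -[2^-1]div1r; apply: le_trans wp; rewrite (bigD1 finset.set0) //= cards0 expr0 mulr1 lerDl.
  by apply: sumr_ge0 => W _; rewrite mulr_ge0 // exprn_ge0 // ltW.
have split_mass A : A \in H -> 2^-1 <= mass ws A + mass wl A.
  move=> AH; have := wH A AH; rewrite (bigD1 finset.set0) ?finset.sub0set //= => h.
  have : \sum_(W : {set X} | (W \subset A) && (W != finset.set0)) w W <= mass ws A + mass wl A.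
    rewrite /mass -big_split /= [leRHS](bigD1 finset.set0) ?finset.sub0set //=.
    apply: ler_wpDl; first by rewrite addr_ge0.
    apply: ler_sum => W /andP[_ W0]; rewrite /ws /wl /small /large lt0n cards_eq0 W0 /=.
    by case: leqP; rewrite ?addr0 ?add0r.
  lra.
pose Hs := [set A in H | 4^-1 <= mass ws A]%SET.
pose Hl := [set A in H | 4^-1 <= mass wl A]%SET.
have [||||Gs Gscov Gscost] := @small_support_cover R X Hs ws p q s ws0 _ _ _ _ q0 p1 qp.
- by move=> W; rewrite /ws; case: ifP; rewrite ?eqxx.
- by move=> A; rewrite inE => /andP[].
- by apply: cost_le => W; rewrite /ws; case: ifP.
- by apply: leq_trans Xs; rewrite ltn_Pmull.
have [|||Gl Glcov Glcost] := @large_support_cover R X Hl wl p q s wl0 _ _ _ X0 Xs (ltW q0) qp4.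
- by move=> W; rewrite /wl; case: ifP; rewrite ?eqxx.
- by move=> A; rewrite inE => /andP[].
- by apply: cost_le => W; rewrite /wl; case: ifP.
exists (Gs :|: Gl)%SET.
  move=> A AH; have [As|As] := leP 4^-1 (mass ws A).
    have [|T TG TA] := Gscov A; first by rewrite inE AH.
    by exists T => //; rewrite inE TG.
  have [|T TG TA] := Glcov A; first by rewrite inE AH; have := split_mass A AH; lra.
  by exists T => //; rewrite inE TG orbT.
apply: (@le_trans _ _ (\sum_(A in Gs) q ^+ #|A| + \sum_(A in Gl) q ^+ #|A|)); last by lra.
rewrite big_mkcond [X in _ <= X + _]big_mkcond [X in _ <= _ + X]big_mkcond -big_split /=.
apply: ler_sum => A _; have qA : 0 <= q ^+ #|A| by rewrite exprn_ge0 // ltW.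
by rewrite inE; case: (A \in Gs); case: (A \in Gl); rewrite ?addr0 ?add0r // lerDl.
Qed.

(** * The iterated logarithm and the constant *)

Lemma le_log2 (R : realType) (x y : R) : 0 < x -> x <= y -> log2 x <= log2 y.
Proof.
move=> x0 xy; rewrite /log2 ler_pM2r ?invr_gt0 ?ln_gt0 ?ltr1n //.
by rewrite ler_ln ?posrE // (lt_le_trans x0).
Qed.

Lemma log2_exp (R : realType) n : log2 (2 ^+ n : R) = n%:R.
Proof.
by rewrite /log2 lnXn // -[ln 2 *+ n]mulr_natl mulfK // gt_eqF // ln_gt0 // ltr1n.
Qed.

Lemma le_loglog (R : realType) (N : R) k : 2 ^+ (2 ^ k) <= N -> k%:R <= log2 (log2 N).
Proof.
move=> kN; rewrite -(log2_exp R k); apply: le_log2; first by rewrite exprn_gt0.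
by rewrite -natrX -(log2_exp R); apply: le_log2; rewrite ?exprn_gt0.
Qed.

Lemma loglog_ge1 (R : realType) n : (0 < n)%N -> 1 <= log2 (log2 (4 * n%:R)) :> R.
Proof.
move=> n0; apply: (le_loglog (k := 1)); rewrite expn1.
have : 1 <= n%:R :> R by rewrite ler1n.
lra.
Qed.

Lemma loglog_scale (R : realType) n : (0 < n)%N ->
  exists2 s, (4 * n <= 2 ^ (2 ^ s))%N &
    (rounds s)%:R <= 25 * log2 (log2 (4 * n%:R)) :> R.
Proof.
move=> n0.
have ex : exists s, (4 * n <= 2 ^ (2 ^ s))%N.
  have le_exp k : (k <= 2 ^ k)%N by apply/ltnW/ltn_expl.
  by exists (4 * n)%N; apply: leq_trans (le_exp _) (le_exp _).
case: (ex_minnP ex) => s sn smin; exists s => //.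
have LL1 := loglog_ge1 R n0.
(* Minimality of [s] gives [2^(2^(s-1)) < 4n] when [s > 0]. With [L >= 1] the double logarithm,
   [6s + 13 <= 6L + 19 <= 25L] follows. *)
have : s%:R <= log2 (log2 (4 * n%:R)) + 1 :> R.
  case: s sn smin => [|k] _ smin; first by lra.
  rewrite -addn1 natrD lerD2r; apply: le_loglog.
  rewrite -natrX -natrM ler_nat ltnW // ltnNge; apply/negP => /smin.
  by rewrite ltnn.
by rewrite /rounds natrD natrM; lra.
Qed.

Lemma fractional_gap (R : realType) : exists2 c : R, 0 < c <= 1 &
  forall (X : finType) (p : R) (H : {set {set X}}) (w : {set X} -> R),
       (0 < #|X|)%N -> 0 < p <= 1 ->
       fractional_cover w H ->
       \sum_(W : {set X}) w W * p ^+ #|W| <= 1 / 2 ->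
       p_small (c * p / log2 (log2 (4 * #|X|%:R))) H.
Proof.
have [e [e0 eE]] : exists e : R, 1 <= e /\ 256 ^+ 2 = e.
  by exists (256 ^+ 2); split=> //; rewrite exprn_ege1 //; lra.
(* [30 * 40 = 16 * 3 * 25] combines the density condition on [q] with the 25 of [loglog_scale]. *)
have [c [c0 c1 ce]] : exists c : R, [/\ 0 < c, c <= 1 & c * e * (30 * 40) = 1].
  have h : 0 < e * (30 * 40) by lra.
  exists (e * (30 * 40))^-1; split; first by rewrite invr_gt0.
    by rewrite invf_le1 //; lra.
  by rewrite -mulrA mulVf // gt_eqF.
exists c; first by rewrite c0.
move=> X p H w X0 /andP[p0 p1] wcov wp.
have [s sX sL] := @loglog_scale R #|X| X0; have L1 := loglog_ge1 R X0.
set LL := log2 _ in sL L1 *; have LL0 : 0 < LL by lra.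
apply: (fractional_cover_p_small X0 sX p1 _ _ wcov wp).
  by apply: divr_gt0 => //; apply: mulr_gt0.
rewrite eE.
have -> : 16 * (3 * rounds s)%:R * (c * p / LL * e) =
    (c * e * (30 * 40)) * ((rounds s)%:R * (p / (25 * LL))) :> R.
  by rewrite natrM; field; rewrite gt_eqF.
rewrite ce mul1r mulrCA ger_pMr // ler_pdivrMr ?mul1r //; lra.
Qed.

(** * Attainment of the maxima *)

Lemma continuous_mul_exp (R : realType) (T : topologicalType) (h k : T -> R) n :
  continuous h -> continuous k -> continuous (fun x => h x * k x ^+ n).
Proof.
move=> ch ck x.
have ce : (k y ^+ n @[y --> x] --> k x ^+ n)%classic.
  apply: (@continuous_comp _ _ _ k (fun y : R => y ^+ n)); first exact: ck.
  exact: exprn_continuous.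
by apply: cvgM ce; apply: ch.
Qed.

Section LargestExists.
Variables (R : realType) (X : finType) (H : {set {set X}}) (V : set R).
Local Open Scope classical_set_scope.

(** [V] restricts the values of [w]: all reals for [p_f], only 0 and 1 for [p_E]. *)
Definition fractional_range : set R := [set p : R | 0 <= p <= 1 /\
  exists2 w : {set X} -> R, (forall W, V (w W)) /\ fractional_cover w H &
      \sum_(W : {set X}) w W * p ^+ #|W| <= 1 / 2].

Lemma fractional_range_max : closed V -> fractional_range !=set0 ->
  exists m, fractional_range m /\ forall x, fractional_range x -> x <= m.
Proof.
move=> clV [p0 [p001 [w0 [w0V w0H] w0p]]].
(* A pair [(p, w)] is one point of a finite power of [R]: coordinate [None] holds [p], coordinate
   [Some W] holds [w W]. *)
pose P := prod_topology (fun _ : option {set X} => R).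
have proj_cont (i : option {set X}) : continuous (fun f : P => f i : R).
  exact: (@proj_continuous _ (fun _ : option {set X} => R) i).
have closed_pre (h : P -> R) (A : set R) : continuous h -> closed A -> closed (h @^-1` A).
  by move=> /continuous_closedP; apply.
pose box := [set f : P | forall i, `[0, 1]%classic (f i)].
have cbox : compact box.
  apply: (@tychonoff _ (fun _ : option {set X} => R) (fun _ => `[0, 1]%classic)) => _.
  exact: segment_compact.
pose covers := [set f : P | forall B, B \in H ->
  1 <= \sum_(W : {set X} | W \subset B) f (Some W)].
pose values := [set f : P | forall W, V (f (Some W))].
pose cheap := [set f : P | \sum_(W : {set X}) f (Some W) * f None ^+ #|W| <= 1 / 2].
have cl_covers : closed covers.
  have -> : covers = \bigcap_(B in [set B | B \in H])
      (fun f : P => \sum_(W : {set X} | W \subset B) f (Some W)) @^-1` [set x | 1 <= x].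
    by apply/seteqP; split => f h B BH; apply: h.
  apply: closed_bigI => B _; apply: closed_pre; last exact: closed_ge.
  apply: continuous_big => [|W _]; [exact: add_continuous | exact: proj_cont].
have cl_values : closed values.
  have -> : values = \bigcap_(W in [set: {set X}]) (fun f : P => f (Some W)) @^-1` V.
    by apply/seteqP; split => f h W; [move=> _; apply: h | apply: h].
  by apply: closed_bigI => W _; apply: closed_pre.
have cl_cheap : closed cheap.
  have -> : cheap = (fun f : P => \sum_(W : {set X}) f (Some W) * f None ^+ #|W|) @^-1`
     [set x | x <= 1 / 2] by [].
  apply: closed_pre; last exact: closed_le.
  apply: continuous_big => [|W _]; first exact: add_continuous.
  by apply: continuous_mul_exp; apply: proj_cont.
have cK : compact (box `&` (covers `&` (values `&` cheap))).
  by apply: compact_closedI => //; do !apply: closedI.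
have K0 : (box `&` (covers `&` (values `&` cheap))) !=set0.
  exists (fun i => if i is Some W then w0 W else p0); split; last by case: w0H.
  by case: w0H => w01 _ [W|] /=; rewrite in_itv /=.
have [f fK fmax] := compact_EVT_max K0 cK (continuous_subspaceT (proj_cont None)).
move: fK; rewrite inE => -[fbox [fcov [fval fcheap]]].
exists (f None); split.
  split; first by have := fbox None; rewrite /= in_itv.
  exists (fun W => f (Some W)) => //; split=> //; split=> // W.
  by have := fbox (Some W); rewrite /= in_itv.
move=> x [x01 [w [wV [w01 wH]] wx]].
apply: (fmax (fun i => if i is Some W then w W else x)); rewrite inE; split=> //.
by move=> [W|] /=; rewrite in_itv /=.
Qed.

End LargestExists.

Lemma largestP (R : realType) (S : set R) :
  (exists m, S m /\ forall x, S x -> x <= m) ->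
  S (largest S) /\ forall x, S x -> x <= largest S.
Proof.
exact: (@xgetPex _ 0 [set m | S m /\ forall x, S x -> x <= m]%classic).
Qed.

Lemma p_small_fractional (R : realType) (X : finType) (H : {set {set X}}) (p : R) :
  p_small p H <-> exists2 w : {set X} -> R,
    (forall W, w W = 0 \/ w W = 1) /\ fractional_cover w H &
    \sum_(W : {set X}) w W * p ^+ #|W| <= 1 / 2.
Proof.
split=> [[G Gcov Gp]|[w [w01 [_ wH]] wp]].
  exists (fun W => (W \in G)%:R); last first.
    apply: le_trans Gp; rewrite [leRHS]big_mkcond; apply: ler_sum => W _.
    by case: ifP; rewrite ?mul1r ?mul0r.
  split; first by move=> W; case: (W \in G); [right|left].
  split=> [W|B /Gcov[A AG AB]]; first by case: (W \in G); rewrite ?lexx ?ler01.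
  by rewrite (bigD1 A) //= AG lerDl sumr_ge0.
exists [set W | w W == 1]%SET.
  move=> B /wH h; apply/exists_inP; apply: contraLR h => /exists_inPn none.
  rewrite -ltNge big1 // => W WB; case: (w01 W) => // w1.
  by have := none W; rewrite inE w1 eqxx WB => /(_ isT).
apply: le_trans wp; rewrite big_mkcond /=; apply: ler_sum => W _; rewrite inE.
by case: (w01 W) => ->; rewrite ?eqxx ?mul1r // mul0r eq_sym oner_eq0.
Qed.

Theorem corollary1p8 (R : realType) :
  (exists2 c : R, 0 < c &
     forall (X : finType) (p : R) (H : {set {set X}}) (w : {set X} -> R),
       (0 < #|X|)%N -> 0 < p <= 1 ->
       fractional_cover w H ->
       \sum_(W : {set X}) w W * p ^+ #|W| <= 1 / 2 ->
       p_small (c * p / log2 (log2 (4 * #|X|%:R))) H)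
  /\
  (exists2 C : R, 0 < C &
     forall (X : finType) (H : {set {set X}}),
       (0 < #|X|)%N -> nontrivial_family (upset H) ->
       p_E R H <= p_f R H /\
       p_f R H <= C * p_E R H * log2 (log2 (4 * #|X|%:R))).
Proof.
have [c /andP[c0 c1] gap] := fractional_gap R; split; first by exists c.
exists c^-1 => [|X H X0 [_ upT]]; first by rewrite invr_gt0.
(* The empty set would generate the whole power set. Without it, [H] covers itself at no cost for
   [p = 0], so both maxima are over nonempty sets. *)
have set0H : finset.set0 \notin H.
  apply/negP => h; apply: upT; apply/setP => A; rewrite !inE.
  by apply/exists_inP; exists finset.set0; rewrite ?finset.sub0set.
have small0 : p_small (0 : R) H.
  exists H => [B BH|]; first by exists B.
  rewrite big1 ?divr_ge0 // => A AH; rewrite expr0n cards_eq0.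
  by case: eqP AH => // ->; rewrite (negbTE set0H).
have EE : [set p : R | 0 <= p <= 1 /\ p_small p H]%classic =
    fractional_range H [set x | x = 0 \/ x = 1]%classic.
  by apply/seteqP; split => p [p01 /p_small_fractional h].
have FE : [set p : R | 0 <= p <= 1 /\ exists2 w : {set X} -> R, fractional_cover w H &
    \sum_(W : {set X}) w W * p ^+ #|W| <= 1 / 2]%classic = fractional_range H setT.
  by apply/seteqP; split => p [p01 [w wH wp]]; split=> //; exists w => //; case: wH.
have EF : (fractional_range H [set x : R | x = 0 \/ x = 1] `<=` fractional_range H setT)%classic.
  by move=> p [p01 [w [_ wH] wp]]; split=> //; exists w.
have E0 : fractional_range H [set x | x = 0 \/ x = 1]%classic (0 : R).
  by rewrite -EE /= lexx ler01.
have cl01 : closed [set x : R | x = 0 \/ x = 1]%classic.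
  by apply: closedU; apply: closed_eq.
have [] := largestP (fractional_range_max cl01 (ex_intro _ _ E0)).
have [] := largestP (fractional_range_max (@closedT _) (ex_intro _ _ (EF _ E0))).
rewrite /p_E /p_f EE FE; set pf := largest _; set pE := largest _ => pfin pfmax pEin pEmax.
split; first exact/pfmax/EF.
have L1 := loglog_ge1 R X0; have pE0 : 0 <= pE by apply: pEmax.
set LL := log2 _ in L1 *; have LL0 : 0 < LL by lra.
case: pfin => /andP[pf0 pf1] [w [_ wH] wp].
have [pf_gt0|] := ltP 0 pf; last first.
  move=> h; apply: le_trans h _; apply: mulr_ge0; last exact: ltW.
  by apply: mulr_ge0 => //; rewrite invr_ge0 ltW.
(* Part (i) applies at the attained value [pf], and [c * pf / LL] is at most 1 since [c] and [pf]
   are at most 1 and [LL] is at least 1. *)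
suff h : c * pf / LL <= pE.
  by move: h; rewrite ler_pdivrMr // => h; rewrite -mulrA ler_pdivlMl.
apply: pEmax; rewrite -EE; split; last by apply: gap wH wp; rewrite ?pf_gt0.
apply/andP; split.
  by apply: divr_ge0; [apply: mulr_ge0 => //; exact: ltW | exact: ltW].
rewrite ler_pdivrMr // mul1r; apply: le_trans L1.
by apply: mulr_ile1 => //; exact: ltW.
Qed.
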